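(* Let $K$ be an algebraically closed field (of arbitrary characteristic) and let $G$ be a linear algebraic group over $K$. Then $G$ is finite if and only if $\beta_{\mathrm{sep}}(G)$ is finite, i.e. $\beta_{\mathrm{sep}}(G)\neq\infty$.
   Context: Varieties are defined over $K$ and identified with their $K$-points. A $G$-module is a finite dimensional $K$-vector space $V$ with a regular linear action of $G$. $\mathcal{O}(V)$ is the ring of polynomial functions on $V$, $\mathcal{O}(V)^{G}$ the subring of $G$-invariant functions, $\mathcal{O}(V)_{d}$ the homogeneous functions of degree $d$ (together with $0$), and $\mathcal{O}(V)_{\le d}=\bigoplus_{i=0}^{d}\mathcal{O}(V)_{i}$; put $\mathcal{O}(V)^G_{\le d}=\mathcal{O}(V)^G\cap \mathcal{O}(V)_{\le d}$. A subset $S\subset\mathcal{O}(V)^{G}$ is called $G$-separating if for all $x,x'\in V$: whenever $f(x)\ne f(x')$ for some $f\in\mathcal{O}(V)^{G}$, there is $h\in S$ with $h(x)\ne h(x')$. Finite separating sets always exist. Define $$\beta_{\mathrm{sep}}(G,V)=\min\{d\mid \mathcal{O}(V)^{G}_{\le d}\text{ is }G\text{-separating}\}\in\mathbb{N},\qquad \beta_{\mathrm{sep}}(G)=\sup\{\beta_{\mathrm{sep}}(G,V)\mid V \text{ a } G\text{-module}\}\in\mathbb{N}\cup\{\infty\}.$$ *)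

(* Defs.v *)
From HB Require Import structures.
From mathcomp Require Import all_boot all_order all_algebra.
From mathcomp Require Import boolp classical_sets cardinality.
From mathcomp Require Import mpoly.

Set Implicit Arguments.
Unset Strict Implicit.
Unset Printing Implicit Defensive.

Import GRing.Theory.

Local Open Scope classical_set_scope.
Local Open Scope ring_scope.

Definition meval_row (K : closedFieldType) m (p : {mpoly K[m]}) (u : 'rV[K]_m) : K :=
  p.@[fun i => u 0 i].

(** ** Linear algebraic groups *)

(* The entries of A followed by 1 / \det A: the affine coordinates of GL_n, whose
   coordinate ring is K[x_ij, 1 / \det]. *)
Definition GLcoord (K : closedFieldType) n (A : 'M[K]_n) : 'rV[K]_(n * n + 1) :=
  row_mx (mxvec A) ((\det A)^-1)%:M.

(* Zariski closed subgroups of GL_n(K). *)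
Record linAlgGroup (K : closedFieldType) (n : nat) := LinAlgGroup {
  lag_set : set 'M[K]_n;
  lag_unit : forall A, lag_set A -> A \in unitmx;
  lag_1 : lag_set 1%:M;
  lag_mul : forall A B, lag_set A -> lag_set B -> lag_set (A *m B);
  lag_inv : forall A, lag_set A -> lag_set (invmx A);
  lag_closed : exists I : set {mpoly K[n * n + 1]}, forall A, A \in unitmx ->
    (lag_set A <-> forall p, I p -> meval_row p (GLcoord A) = 0)
}.

(** ** Polynomial functions on a finite dimensional vector space *)

Definition vcoord (K : closedFieldType) (V : vectType K) (v : V) : 'rV[K]_(\dim {:V}) :=
  \row_i coord (vbasis {:V}) i v.

Definition polyfun (K : closedFieldType) (V : vectType K) : set (V -> K) :=
  [set f : V -> K | exists p : {mpoly K[\dim {:V}]},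
     forall v, f v = meval_row p (vcoord v)].
Arguments polyfun {K} V _.

Definition polyfun_homog (K : closedFieldType) (V : vectType K) (d : nat) : set (V -> K) :=
  [set f : V -> K | exists2 p : {mpoly K[\dim {:V}]},
     p \is d.-homog & forall v, f v = meval_row p (vcoord v)].
Arguments polyfun_homog {K} V d _.

Definition polyfun_le (K : closedFieldType) (V : vectType K) (d : nat) : set (V -> K) :=
  [set f : V -> K | exists2 F : 'I_d.+1 -> V -> K,
     forall i : 'I_d.+1, polyfun_homog V i (F i) & forall v, f v = \sum_(i < d.+1) F i v].
Arguments polyfun_le {K} V d _.

(** ** G-modules *)

(* The values of [gm_act] outside G are irrelevant.  [gm_regular] says that the action
   map G * V -> V is a morphism of varieties: its coordinates are polynomials in the
   coordinates of GL_n and those of V. *)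
Record Gmodule (K : closedFieldType) (n : nat) (G : linAlgGroup K n) := GModule {
  gm_space :> vectType K;
  gm_act : 'M[K]_n -> 'End(gm_space);
  gm_act1 : forall v, gm_act 1%:M v = v;
  gm_actM : forall A B, lag_set G A -> lag_set G B -> forall v,
    gm_act (A *m B) v = gm_act A (gm_act B v);
  gm_regular : forall i : 'I_(\dim {:gm_space}),
    exists P : {mpoly K[n * n + 1 + \dim {:gm_space}]}, forall A, lag_set G A -> forall v,
      vcoord (gm_act A v) 0 i = meval_row P (row_mx (GLcoord A) (vcoord v))
}.

Definition polyinv (K : closedFieldType) n (G : linAlgGroup K n) (V : Gmodule G) :
    set (V -> K) :=
  [set f | polyfun V f /\ forall A, lag_set G A -> forall v, f (gm_act V A v) = f v].
Arguments polyinv {K n G} V _.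

Definition polyinv_le (K : closedFieldType) n (G : linAlgGroup K n) (V : Gmodule G)
    (d : nat) : set (V -> K) :=
  polyinv V `&` polyfun_le V d.
Arguments polyinv_le {K n G} V d _.

Definition separating (K : closedFieldType) n (G : linAlgGroup K n) (V : Gmodule G)
    (S : set (V -> K)) : Prop :=
  S `<=` polyinv V /\
  forall x x' : V, (exists2 f, polyinv V f & f x <> f x') ->
    exists2 h, S h & h x <> h x'.
Arguments separating {K n G} V S.

(** ** The numbers beta_sep *)

Variant enat : Type := Fin of nat | Infty.

Definition le_enat (a b : enat) : Prop :=
  match a, b with
  | _, Infty => True
  | Infty, Fin _ => False
  | Fin p, Fin q => (p <= q)%N
  end.

(* The least element of A, with the convention that the minimum of the empty set is
   Infty. *)
Definition min_enat (A : set nat) : enat :=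
  match pselect (exists d, `[< A d >]) with
  | left exA => Fin (ex_minn exA)
  | right _ => Infty
  end.

(* The least upper bound of B: Infty when B has no upper bound in nat. *)
Definition sup_enat (B : set enat) : enat :=
  min_enat [set d | forall b, B b -> le_enat b (Fin d)].

(* This is always of the form [Fin d], because some finite set of invariants is
   separating; the convention on the empty set plays no role here. *)
Definition beta_sep_mod (K : closedFieldType) n (G : linAlgGroup K n) (V : Gmodule G) :
    enat :=
  min_enat [set d | separating V (polyinv_le V d)].

Definition beta_sep (K : closedFieldType) n (G : linAlgGroup K n) : enat :=
  sup_enat [set b | exists V : Gmodule G, b = beta_sep_mod V].

(* Main.v *)
Require Import Defs.
From HB Require Import structures.
From mathcomp Require Import all_boot all_order all_algebra.
From mathcomp Require Import boolp classical_sets cardinality.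
From mathcomp Require Import mpoly.

(* If G is finite and x, x' lie in different orbits, choose a linear form l with
   l (x' - g x) <> 0 for all g in G; then v |-> prod_g (l x' - l (g v)) is an invariant of
   degree |G| that vanishes at x' but not at x.

   If G is infinite, its closure in the projective completion of the space of n * n
   matrices has a point B at infinity: every form of degree k that agrees on G with a
   polynomial of degree < k vanishes at B.  Given d, let r = d + 1 and let G act on
   V = M_n (+) (K^n)^{(x) r} by g (M, T) = (g M, T g^{-1}).  Choose i, j with B_ij <> 0.
   The contraction of T with the r-th power of the j-th column of M separates
   (1, (e_i B)^{(x) r}) from (1, 0).  An invariant F of degree at most d does not: if F_b
   is its part of degree b > 0 in T, then F_b (1, (e_i g)^{(x) r}) = F_b (g, e_i^{(x) r})
   on G, where the left side is a form of degree r b in g and the right side has degree at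
   most d < r b; hence F_b (1, (e_i B)^{(x) r}) = 0.

   The point B comes from a projective Nullstellensatz, proved by elimination. *)

Set Implicit Arguments.
Unset Strict Implicit.
Unset Printing Implicit Defensive.

Import GRing.Theory.

Local Open Scope ring_scope.
Local Open Scope classical_set_scope.

(** * A projective Nullstellensatz *)

(** When both leading coefficients survive [f], the Sylvester matrix keeps its size and [f] acts on
    it entrywise. *)
Lemma map_resultant_rmorph (aR rR : nzRingType) (f : {rmorphism aR -> rR})
    (p q : {poly aR}) :
    f (lead_coef p) != 0 -> f (lead_coef q) != 0 ->
  f (resultant p q) = resultant (map_poly f p) (map_poly f q).
Proof.
move=> nz_fp nz_fq; rewrite /resultant /Sylvester_mx !size_map_poly_id0 //.
rewrite -det_map_mx map_col_mx; congr (\det (col_mx _ _));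
  by apply: map_lin1_mx => v; rewrite /= map_poly_rV rmorphM /= map_rVpoly.
Qed.

(** * Polynomials in n + 1 variables as univariate polynomials in the last one *)

Section LastVariable.
Variables (n : nat) (R : comNzRingType).

Local Notation widen := (widen_ord (leqnSn n)).

Lemma widen_lift (i : 'I_n) : widen i = lift ord_max i.
Proof. by apply/val_inj; rewrite /= /bump leqNgt ltn_ord. Qed.

Definition mnm_trunc (m : 'X_{1..n.+1}) : 'X_{1..n} :=
  [multinom m (widen i) | i < n].

Lemma mnm_truncK (m : 'X_{1..n.+1}) :
  (mnmwiden (mnm_trunc m) + U_(ord_max) *+ m ord_max)%MM = m.
Proof.
apply/mnmP => i; rewrite mnmDE mulmnE mnm1E.
case: (unliftP ord_max i) => [j ->|->].
  by rewrite -widen_lift mnmwiden_widen mnmE widen_lift (negPf (neq_lift _ _)) addn0.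
by rewrite mnmwiden_ordmax eqxx mul1n.
Qed.

Lemma muniX (m : 'X_{1..n.+1}) :
  muni ('X_[m] : {mpoly R[n.+1]}) = 'X_[mnm_trunc m] *: 'X^(m ord_max).
Proof. by rewrite muniE msuppX big_seq1 mcoeffX eqxx scale1r. Qed.

Definition muni_inv (P : {poly {mpoly R[n]}}) : {mpoly R[n.+1]} :=
  (map_poly (@mwiden n R) P).['X_ord_max].

Lemma muni_invD P Q : muni_inv (P + Q) = muni_inv P + muni_inv Q.
Proof. by rewrite /muni_inv rmorphD hornerD. Qed.

Lemma muni_invM P Q : muni_inv (P * Q) = muni_inv P * muni_inv Q.
Proof. by rewrite /muni_inv rmorphM hornerM. Qed.

Lemma muni_invC c : muni_inv c%:P = mwiden c.
Proof. by rewrite /muni_inv map_polyC hornerC. Qed.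

Lemma muniK (p : {mpoly R[n.+1]}) : muni_inv (muni p) = p.
Proof.
elim/mpolyind: p => [|c m p _ _ IH].
  by rewrite muni0 /muni_inv rmorph0 horner0.
rewrite muniD muni_invD; congr (_ + _); last exact: IH.
rewrite muniZ muniX -!mul_polyC !muni_invM !muni_invC mwidenC mul_mpolyC.
congr (_ *: _); rewrite /muni_inv map_polyXn hornerXn mwidenX mpolyXn -mpolyXD.
by rewrite mnm_truncK.
Qed.

Definition extend (a : 'I_n -> R) (z : R) (i : 'I_n.+1) : R :=
  if unlift ord_max i is Some j then a j else z.

Lemma meval_extend a z (p : {mpoly R[n.+1]}) :
  p.@[extend a z] = (map_poly (meval a) (muni p)).[z].
Proof.
elim/mpolyind: p => [|c m p _ _ IH].
  by rewrite muni0 map_poly0 horner0 meval0.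
rewrite mevalD IH muniD rmorphD hornerD; congr (_ + _).
rewrite mevalZ mevalX muniZ muniX -!mul_polyC !rmorphM /= !map_polyC /= map_polyXn mevalC.
rewrite !hornerM !hornerC hornerXn mevalX big_ord_recr /=.
congr (_ * (_ * _)).
  by apply: eq_bigr => i _; rewrite /extend widen_lift liftK mnmE widen_lift.
by rewrite /extend unlift_none.
Qed.

Lemma mdeg_mnmwiden (m : 'X_{1..n}) : mdeg (mnmwiden m) = mdeg m.
Proof.
rewrite !mdegE big_ord_recr /= mnmwiden_ordmax addn0.
by apply: eq_bigr => i _; rewrite mnmwiden_widen.
Qed.

Lemma pihomog_mwiden k (p : {mpoly R[n]}) :
  pihomog mdeg k (mwiden p) = mwiden (pihomog mdeg k p).
Proof.
elim/mpolyind: p => [|c m p _ _ IH]; first by rewrite !raddf0.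
rewrite !raddfD /= IH; congr (_ + _).
rewrite mwidenZ !linearZ /= mwidenZ mwidenX !pihomogX /= mdeg_mnmwiden.
by case: ifP => _; rewrite ?mwidenX ?mwiden0.
Qed.

Lemma mnm_trunc_eq0 (m : 'X_{1..n.+1}) :
  mnm_trunc m = 0%MM -> m = (U_(ord_max) *+ mdeg m)%MM.
Proof.
move=> t0; rewrite -[LHS]mnm_truncK t0 mnmwiden0 add0m; congr (_ *+ _)%MM.
have := congr1 mdeg (mnm_truncK m).
by rewrite t0 mnmwiden0 add0m mdegMn mdeg1 mul1n.
Qed.

(* The last coordinate point (0, ..., 0, 1) sees only the pure power of the
   last variable, so a form that does not vanish there is monic in it up to a
   constant. *)
Lemma coef_muni_homog D (f : {mpoly R[n.+1]}) : f \is D.-homog ->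
  (size (muni f) <= D.+1)%N /\ (muni f)`_D = (f@_(U_(ord_max) *+ D))%:MP.
Proof.
move=> fD.
have mD m : mdeg m = (mdeg (mnm_trunc m) + m ord_max)%N.
  by rewrite -{1}(mnm_truncK m) mdegD mdegMn mdeg1 mul1n mdeg_mnmwiden.
have msupD m : m \in msupp f -> mdeg m = D by move/(dhomog_mf fD).
split.
  apply/leq_sizeP => j ltj; rewrite muniE coef_sum big1_seq // => m /andP[_ mf].
  rewrite !coefZ coefXn -[_ == _]negbK; have := msupD _ mf; rewrite mD => eqD.
  rewrite (_ : j != m ord_max) ?mulr0 ?scaler0 // neq_ltn orbC.
  by rewrite (leq_ltn_trans _ ltj) // -eqD leq_addl.
rewrite muniE coef_sum.
(* Once the last variable takes up the whole degree [D], no other variable can occur. *)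
have trunc0 m : m \in msupp f -> D = m ord_max -> m = (U_(ord_max) *+ D)%MM.
  move=> /msupD eqD eqm; rewrite -[in RHS]eqD; apply/mnm_trunc_eq0/eqP.
  by rewrite -mdeg_eq0 -(eqn_add2r (m ord_max)) -mD eqD -eqm.
set m0 := (U_(ord_max) *+ D)%MM.
have m0D : m0 ord_max = D by rewrite mulmnE mnm1E eqxx mul1n.
have m0t : mnm_trunc m0 = 0%MM.
  apply/mnmP=> i; rewrite mnmE mulmnE mnm1E widen_lift (negPf (neq_lift _ _)).
  by rewrite mnm0E.
case: (boolP (m0 \in msupp f)) => m0f.
  rewrite (bigD1_seq m0) //= ?msupp_uniq // big1_seq => [|m /andP[mm0 mf]].
    rewrite addr0 m0D -/(mnm_trunc m0) m0t coefZ coefXn eqxx mulr1.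
    by rewrite -mul_mpolyC mpolyX0 mulr1.
  rewrite !coefZ coefXn; case: eqP => [eqm|]; last by rewrite mulr0.
  by rewrite (trunc0 m mf eqm) eqxx in mm0.
rewrite big1_seq => [|m /andP[_ mf]]; first by rewrite memN_msupp_eq0.
rewrite !coefZ coefXn; case: eqP => [eqm|]; last by rewrite mulr0.
by rewrite /m0 -(trunc0 m mf eqm) mf in m0f.
Qed.

End LastVariable.

(** * Radicals of ideals *)

Section Radical.
Variables (R : comNzRingType) (J : R -> Prop).
Hypotheses (JD : forall p q, J p -> J q -> J (p + q))
           (J0 : J 0) (JM : forall c p, J p -> J (c * p)).

(** In the binomial expansion of exponent [a + b], each term contains [p ^+ a] or [q ^+ b]. *)
Lemma radicalD p q : (exists N, J (p ^+ N)) -> (exists N, J (q ^+ N)) ->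
  exists N, J ((p + q) ^+ N).
Proof.
move=> [a Ja] [b Jb]; exists (a + b)%N; rewrite exprDn.
apply: (big_ind J) => // i _; rewrite -mulr_natl; apply: JM.
have [lei|lti] := leqP b i.
  by rewrite -(subnK lei) exprD mulrA; apply: JM.
have lea : (a <= a + b - i)%N by rewrite -addnBA ?leq_addr // ltnW.
by rewrite -(subnK lea) exprD mulrAC; apply: JM.
Qed.

Lemma radicalM c p : (exists N, J (p ^+ N)) -> exists N, J ((c * p) ^+ N).
Proof. by move=> [a Ja]; exists a; rewrite exprMn; apply: JM. Qed.

Lemma radical0 : exists N, J (0 ^+ N).
Proof. by exists 1%N; rewrite expr1. Qed.

End Radical.

(** The shift by [size p] puts [f] above all terms of [p]. In [extend_zero] it gives a member of the
    ideal a constant leading coefficient without changing it modulo [f]. *)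
Lemma size_addXnM (R : nzRingType) (p f : {poly R}) : f != 0 ->
  size (p + 'X^(size p) * f) = (size p + size f)%N /\
  lead_coef (p + 'X^(size p) * f) = lead_coef f.
Proof.
move=> f0; have sXf : size ('X^(size p) * f) = (size p + size f)%N.
  by rewrite -commr_polyXn size_mulXn.
have ltp : (size p < size ('X^(size p) * f)%R)%N.
  by rewrite sXf -[X in (X < _)%N]addn0 ltn_add2l size_poly_gt0.
rewrite addrC size_polyDl // lead_coefDl //; split=> //.
by rewrite lead_coef_monicM // monicXn.
Qed.

(** * Elimination of the last variable *)

Section Elimination.
Variables (K : closedFieldType) (n : nat) (J : {mpoly K[n.+1]} -> Prop).
Hypotheses (JD : forall p q, J p -> J q -> J (p + q))
           (JM : forall c p, J p -> J (c * p)).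

(* If the specialization at [a] of the ideal were trivial, the resultant of a
   witness with the monic [f] would lie in the elimination ideal without
   vanishing at [a]. *)
Lemma extend_zero (f : {mpoly K[n.+1]}) (D : nat) (c : K) (a : 'I_n -> K) :
  J f -> (size (muni f) <= D.+1)%N -> (muni f)`_D = c%:MP -> c != 0 ->
  (0 < D)%N ->
  (forall p, J (mwiden p) -> p.@[a] = 0) ->
  exists z, forall p, J p -> p.@[extend a z] = 0.
Proof.
move=> Jf sf cf c0 D0 Ja.
pose hat p := map_poly (meval a) (muni p).
have hatD p q : hat (p + q) = hat p + hat q by rewrite /hat muniD rmorphD.
have hatM p q : hat (p * q) = hat p * hat q by rewrite /hat muniM rmorphM.
(* Since [up] is a section of [hat], the specializations [hat p] with [p] in [J] form an ideal of
   K[X]. *)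
pose up (q : {poly K}) : {mpoly K[n.+1]} :=
  (map_poly (@mpolyC n.+1 K) q).['X_ord_max].
have hat_up q : hat (up q) = q.
  elim/poly_ind: q => [|q d IH].
    by rewrite /up map_poly0 horner0 /hat muni0 map_poly0.
  rewrite /up rmorphD rmorphM /= map_polyX map_polyC /= hornerD hornerMX hornerC.
  rewrite hatD hatM IH; congr (_ * _ + _).
    rewrite /hat muniX (_ : mnm_trunc _ = 0%MM); last first.
      by apply/mnmP=> i; rewrite mnmE mnm1E widen_lift (negPf (neq_lift _ _)) mnm0E.
    by rewrite mnm1E eqxx mpolyX0 scale1r map_polyX.
  by rewrite /hat muniC map_polyC /= mevalC.
have szf : size (muni f) = D.+1.
  apply/eqP; rewrite eqn_leq sf ltnNge; apply/negP => /leq_sizeP/(_ D (leqnn _)).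
  by rewrite cf => /eqP; rewrite mpolyC_eq0 (negPf c0).
have lcf : lead_coef (muni f) = c%:MP by rewrite lead_coefE szf.
have hatf : size (hat f) = D.+1.
  by rewrite size_map_poly_id0 ?szf // lcf mevalC.
have hatf0 : hat f != 0 by rewrite -size_poly_gt0 hatf.
have no1 p : J p -> hat p = 1 -> False.
  move=> Jp p1; pose k := (size (muni p)).
  (* [P] stands for another member of [J], with [hat P] still 1 modulo [hat f]; its leading
     coefficient is the constant [c], so its resultant with [f] commutes with specialization at
     [a]. *)
  pose P := muni p + 'X^k * muni f.
  have JP : J (muni_inv P).
    have -> : muni_inv P = p + muni_inv 'X^k * f.
      by rewrite muni_invD muni_invM; congr (_ + _ * _); apply: muniK.
    by apply: JD; last apply: JM.
  have nz_f : muni f != 0 by rewrite -size_poly_gt0 szf.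
  have [sP lcP] : size P = (k + D.+1)%N /\ lead_coef P = c%:MP.
    by rewrite -szf -lcf; apply: size_addXnM nz_f.
  have szP1 : (1 < size P)%N by rewrite sP addnS ltnS ltn_addl.
  have szf1 : (1 < size (muni f))%N by rewrite szf ltnS.
  have [[u v] /= _ res] := resultant_in_ideal szP1 szf1.
  have Jres : J (mwiden (resultant P (muni f))).
    rewrite -muni_invC res muni_invD !muni_invM; apply: JD; apply: JM.
      exact: JP.
    by rewrite muniK.
  have := Ja _ Jres; rewrite map_resultant_rmorph; first last.
  - by rewrite lcf /= mevalC.
  - by rewrite lcP /= mevalC.
  apply/eqP; rewrite resultant_eq0 -leqNgt.
  have -> : map_poly (meval a) P = 1 + 'X^k * hat f.
    by rewrite /P rmorphD rmorphM /= map_polyXn -p1.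
  have : coprimep (1 + 'X^k * hat f) (hat f).
    apply/Bezout_eq1_coprimepP; exists (1, - 'X^k) => /=.
    by rewrite mul1r mulNr addrK.
  by rewrite coprimep_def => /eqP ->.
have [z zP] : exists z, forall p, J p -> root (hat p) z.
  clear szf lcf hatf; clearbody hat up.
  (* A nonzero specialization of least size divides all the others, by division with remainder. It
     is not constant by [no1], so it has a root, which is then common to all. *)
  have exP : exists k, `[< exists p, [/\ J p, hat p != 0 & size (hat p) = k] >].
    by exists (size (hat f)); apply/asboolP; exists f.
  case: (ex_minnP exP) => s /asboolP[g [Jg g0 sg]] smin.
  have [s1|/closed_rootP[z gz]] := eqVneq (size (hat g)) 1%N; last first.
    exists z => p Jp.
    have Jr : J (p + up (- (hat p %/ hat g)) * g) by apply: JD => //; apply: JM.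
    have hr : hat (p + up (- (hat p %/ hat g)) * g) = hat p %% hat g.
      by rewrite hatD hatM hat_up {1}(divp_eq (hat p) (hat g)) mulNr addrAC subrr add0r.
    have [r0|rN0] := eqVneq (hat p %% hat g) 0.
      by rewrite (divp_eq (hat p) (hat g)) r0 addr0 rootM gz orbT.
    have /smin : `[< exists q, [/\ J q, hat q != 0 & size (hat q) = size (hat p %% hat g)] >].
      by apply/asboolP; eexists; split; first exact: Jr; rewrite hr.
    by rewrite leqNgt -sg ltn_modp g0 => /negP; case.
  have [d d0 gd] := size_poly1P _ (introT eqP s1).
  have [] := no1 (up (d^-1)%:P * g); first exact: JM.
  by rewrite hatM hat_up gd -polyCM mulVf.
by exists z => p Jp; rewrite meval_extend; apply/rootP/zP.
Qed.

End Elimination.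

(** Induction on [n]. Either the last coordinate point [e] is a zero of [J], or [J] contains a form
    [g] that is monic in the last variable up to a constant. In the second case the induction
    hypothesis applies to the elimination ideal: a zero of it extends by [extend_zero], and if it
    contains powers of all its variables, then [g] provides a power of the last one. *)
Lemma projective_nullstellensatz (K : closedFieldType) n (J : {mpoly K[n]} -> Prop) :
  J 0 -> (forall p q, J p -> J q -> J (p + q)) ->
  (forall c p, J p -> J (c * p)) ->
  (forall k p, J p -> J (pihomog mdeg k p)) ->
  (exists v : 'I_n -> K, (exists i, v i != 0) /\ forall p, J p -> p.@[v] = 0) \/
  (forall i, exists N, J ('X_i ^+ N)).
Proof.
elim: n J => [|n IH] J J0 JD JM JH; first by right; case.
pose e : 'I_n.+1 -> K := extend (fun=> 0) 1.
case: (pselect (forall p, J p -> p.@[e] = 0)) => [ez|/existsNP[f /not_implyP[Jf /eqP fe]]].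
  by left; exists e; split=> //; exists ord_max; rewrite /e /extend unlift_none oner_neq0.
have [D fDe] : exists D, (pihomog mdeg D f).@[e] != 0.
  apply: contrapT => /forallNP noD; case/negP: fe; apply/eqP.
  rewrite (pihomog_partitionE (leqnn (mmeasure mdeg f))) raddf_sum big1 //= => i _.
  by apply/eqP/negP => /negP; apply: noD.
move: {Jf fe}(JH D f Jf) (pihomogP mdeg D f) fDe; set g := pihomog mdeg D f.
move=> Jg gD ge; have [sg cg] := coef_muni_homog gD.
set c := g@_(U_(ord_max) *+ D) in cg.
have c0 : c != 0.
  apply: contraNneq ge => c0; rewrite mevalE big1_seq // => m /andP[_ mg].
  have [m0|/existsP[i mi]] := boolP [forall i : 'I_n, m (lift ord_max i) == 0%N].
    rewrite (_ : m = (U_(ord_max) *+ D)%MM) -?/c ?c0 ?mul0r //.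
    have t0 : mnm_trunc m = 0%MM.
      by apply/mnmP=> i; rewrite mnmE widen_lift mnm0E; apply/eqP/(forallP m0).
    by rewrite -(dhomog_mf gD mg); apply: mnm_trunc_eq0.
  by rewrite (bigD1 (lift ord_max i)) //= /e /extend liftK expr0n (negPf mi) mul0r mulr0.
(* In degree 0 the form [g] is a nonzero constant, so [J] contains 1. *)
have [D0|D0] := posnP D.
  right=> i; exists 0%N; rewrite expr0.
  have : g = c%:MP.
    rewrite -(muniK g) (_ : muni g = c%:MP%:P) ?muni_invC ?mwidenC //.
    by rewrite -cg D0; apply: size1_polyC; rewrite -D0.
  by move=> gc; rewrite -(mpolyC1 n.+1 K) -(mulVf c0) mpolyCM -gc; apply: JM.
have [|||k p|[a [[i ai] Ja]]|rad] := IH (fun p => J (mwiden p)).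
- by rewrite mwiden0.
- by move=> p q Jp Jq; rewrite mwidenD; apply: JD.
- by move=> q p Jp; rewrite mwidenM; apply: JM.
- by move=> Jp; rewrite -pihomog_mwiden; apply: JH.
- have [z Jz] := extend_zero JD JM Jg sg cg c0 D0 Ja.
  left; exists (extend a z); split=> //.
  by exists (lift ord_max i); rewrite /extend liftK.
have radw (i : 'I_n) : exists N, J ('X_(lift ord_max i) ^+ N).
  have [N] := rad i; rewrite rmorphXn /= mwidenX mnmwiden1 widen_lift.
  by exists N.
right=> i; case: (unliftP ord_max i) => [j ->|->]; first exact: radw.
(* Each monomial of [g] besides the pure power involves another variable and so lies in the radical
   of [J]; subtracting them from [g] leaves the pure power. *)
have : exists N, J ((c%:MP * 'X_ord_max ^+ D) ^+ N).
  rewrite (_ : c%:MP * 'X_ord_max ^+ D = g + - (g - c *: 'X_[U_(ord_max) *+ D])); last first.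
    by rewrite opprB addrC subrK mul_mpolyC mpolyXn.
  apply: (radicalD JD J0 JM); first by exists 1%N; rewrite expr1.
  rewrite -mulN1r; apply: (radicalM JM).
  set m0 := (U_(ord_max) *+ D)%MM.
  have -> : g - c *: 'X_[m0] = \sum_(m <- msupp g | m != m0) g@_m *: 'X_[m].
    have [m0g|m0g] := boolP (m0 \in msupp g).
      rewrite {1}[g]mpolyE (bigD1_seq m0) ?msupp_uniq //=.
      by rewrite -[X in _ - X]/(g@_m0 *: 'X_[m0]) addrAC subrr add0r.
    by move: c0; rewrite /c (memN_msupp_eq0 m0g) eqxx.
  rewrite big_seq_cond; apply: (big_ind (fun p => exists N, J (p ^+ N))).
  + exact: radical0.
  + exact: radicalD.
  move=> m /andP[mg mm0]; rewrite -mul_mpolyC; apply: (radicalM JM).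
  have [k mk] : exists k : 'I_n, (0 < m (lift ord_max k))%N.
    apply: contrapT => /forallNP k0; case/eqP: mm0.
    have t0 : mnm_trunc m = 0%MM.
      apply/mnmP=> k; rewrite mnmE widen_lift mnm0E; apply/eqP.
      by rewrite -leqn0 leqNgt; apply/negP/k0.
    by rewrite /m0 -(dhomog_mf gD mg); apply: mnm_trunc_eq0.
  have -> : 'X_[m] = 'X_[m - U_(lift ord_max k)] * 'X_(lift ord_max k) :> {mpoly K[n.+1]}.
    by rewrite -mpolyXD submK // lep1mP -lt0n.
  exact: radicalM.
move=> [N JN]; exists (D * N)%N.
rewrite exprM -[X in J X]mul1r -(mpolyC1 n.+1 K) -(mulVf (expf_neq0 N c0)).
rewrite mpolyCM -mulrA; apply: JM; move: JN.
by rewrite exprMn rmorphXn.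
Qed.

(** * Points at infinity *)

(** [msize] is the degree plus one, so only one of the two bounds carries a successor. *)
Lemma msizeM_leq (R : idomainType) n (p q : {mpoly R[n]}) a b :
  (msize p <= a.+1)%N -> (msize q <= b)%N -> (msize (p * q) <= a + b)%N.
Proof.
move=> pa qb; have [->|p0] := eqVneq p 0; first by rewrite mul0r msize0.
have [->|q0] := eqVneq q 0; first by rewrite mulr0 msize0.
rewrite msizeM //.
by rewrite (mpolySpred _ p0) addSn /= leq_add // -ltnS -(mpolySpred _ p0).
Qed.

Lemma pihomogXM (R : nzRingType) n k m (p : {mpoly R[n]}) :
  pihomog mdeg k (p * 'X_[m]) =
  if (mdeg m <= k)%N then pihomog mdeg (k - mdeg m) p * 'X_[m] else 0.
Proof.
elim/mpolyind: p => [|c m' p _ _ IH].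
  by rewrite mul0r !raddf0 mul0r if_same.
rewrite mulrDl raddfD /= {}IH -scalerAl -mpolyXD !linearZ /= pihomogX /= mdegD.
case: leqP => km; last by rewrite gtn_eqF ?scaler0 ?addr0 // ltn_addl.
rewrite raddfD /= linearZ /= pihomogX /= mulrDl; congr (_ + _).
rewrite (_ : (_ + _ == k)%N = (mdeg m' == k - mdeg m)%N); last first.
  by rewrite -[in RHS](eqn_add2r (mdeg m)) subnK.
by case: ifP => _; rewrite ?scaler0 ?mul0r // mpolyXD scalerAl.
Qed.

Section Infinity.
Variables (K : closedFieldType) (n : nat) (S : set ('I_n -> K)).

Definition agree (p q : {mpoly K[n]}) := forall x, S x -> p.@[x] = q.@[x].

(** Modulo agreement on [S], the powers of a coordinate lie in a finite dimensional space. Hence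
    each coordinate is a root of a fixed nonzero polynomial on [S], and [S] lies in a finite box. *)
Lemma finite_of_bounded_degree M :
  (forall p, exists2 q, (msize q <= M)%N & agree p q) -> finite_set S.
Proof.
move=> bnd.
have annih i : exists2 r : {poly K}, r != 0 & forall x, S x -> root r (x i).
  pose D := #|{: 'X_{1..n < M}}|.
  have /choice[Q QP] : forall j : nat, exists q : {mpoly K[n]},
      (msize q <= M)%N /\ agree ('X_i ^+ j) q.
    by move=> j; have [q qM qa] := bnd ('X_i ^+ j); exists q.
  (* The [D.+1] reduced powers have only [D] possible monomials, so a nonzero row [c] kills the
     matrix of their coefficients. *)
  pose B : 'M[K]_(D.+1, D) := \matrix_(j, k) (Q j)@_(enum_val k : 'X_{1..n < M}).
  have : kermx B != 0.
    rewrite -mxrank_eq0 mxrank_ker -lt0n subn_gt0 ltnS.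
    exact: rank_leq_col.
  case/rowV0Pn => c /sub_kermxP cB c0.
  exists (rVpoly c).
    by apply: contraNneq c0 => r0; rewrite -[c]rVpolyK r0 linear0.
  move=> x Sx; have comb0 : \sum_(j < D.+1) c 0 j *: Q j = 0.
    apply/mpolyP => m; rewrite mcoeff0 raddf_sum /=.
    have [mM|mM] := ltnP (mdeg m) M.
      have /rowP/(_ (enum_rank (BMultinom mM))) := cB.
      rewrite !mxE => cBk; rewrite -[RHS]cBk; apply: eq_bigr => j _.
      by rewrite mcoeffZ mxE enum_rankK.
    rewrite big1 // => j _; rewrite mcoeffZ memN_msupp_eq0 ?mulr0 //.
    by apply: msize_mdeg_ge; apply: leq_trans mM; case: (QP j).
  apply/rootP; rewrite /rVpoly horner_poly.
  rewrite -[RHS](meval0 x) -comb0 raddf_sum /=; apply: eq_bigr => j _.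
  rewrite insubT // => ltj; rewrite (_ : Sub _ _ = j); last exact/val_inj.
  by rewrite mevalZ -((QP j).2 x Sx) rmorphXn /= mevalXU.
have /choice[rs rsP] : forall i, exists s : seq K, forall x, S x -> x i \in s.
  move=> i; have [r r0 rS] := annih i; have [s rE] := closed_field_poly_normal r.
  exists s => x /rS; rewrite rE rootZ ?lead_coef_eq0 //.
  by rewrite root_prod_XsubC.
(* Index tuples into the root lists cover [S]; the default 0 of [nth] past the end of a list only
   enlarges the image. *)
pose L := (\max_(i < n) size (rs i))%N.
pose phi (t : {ffun 'I_n -> 'I_L.+1}) (i : 'I_n) := nth 0 (rs i) (t i).
apply: (@sub_finite_set _ _ (phi @` setT)); last exact/finite_image/finite_finset.
move=> x Sx; exists [ffun i => inord (index (x i) (rs i))] => //.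
apply/funext => i; rewrite /phi ffunE inordK ?nth_index ?rsP //.
rewrite ltnS (leq_trans (index_size _ _)) //.
exact: (leq_bigmax (F := fun i => size (rs i))).
Qed.

(** If the ideal [J] below contains a power of every variable, then on [S] every monomial of large
    degree can be rewritten in lower degree, which forces [S] to be finite. Otherwise [J] has a
    projective zero. *)
Lemma point_at_infinity : ~ finite_set S ->
  exists v : 'I_n -> K, (exists i, v i != 0) /\
    forall k p q, p \is k.-homog -> (msize q <= k)%N -> agree p q -> p.@[v] = 0.
Proof.
move=> infS.
(* [J] is spanned by the top degree parts of the equations of [S]; it defines the projective closure
   of [S] at infinity. *)
pose J (p : {mpoly K[n]}) := forall k, exists2 q, (msize q <= k)%N &
  agree (pihomog mdeg k p) q.
have agreeD p q p' q' : agree p q -> agree p' q' -> agree (p + p') (q + q').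
  by move=> h h' x Sx; rewrite !mevalD h ?h'.
have agreeM r p q : agree p q -> agree (r * p) (r * q).
  by move=> h x Sx; rewrite !mevalM h.
have J0 : J 0.
  by move=> k; exists 0; rewrite ?msize0 // raddf0.
have JD p q : J p -> J q -> J (p + q).
  move=> Jp Jq k; have [p' p'k p'P] := Jp k; have [q' q'k q'P] := Jq k.
  exists (p' + q'); last by rewrite raddfD; apply: agreeD.
  by apply: leq_trans (msizeD_le _ _) _; rewrite geq_max p'k.
have JM r p : J p -> J (r * p).
  move=> Jp; elim/mpolyind: r => [|c m r _ _ IH]; first by rewrite mul0r.
  rewrite mulrDl; apply: (JD) => // k.
  rewrite -scalerAl linearZ /= [_ * p]mulrC pihomogXM.
  case: leqP => mk; last by exists 0; rewrite ?msize0 // scaler0.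
  have [q qk qP] := Jp (k - mdeg m)%N.
  exists (c *: ('X_[m] * q)).
    apply: leq_trans (msizeZ_le _ _) _.
    by rewrite -(subnKC mk); apply: msizeM_leq; rewrite ?msizeX.
  by rewrite -!mul_mpolyC mulrC [_ * 'X_[m]]mulrC mulrC; do 2!apply: (agreeM).
have JH k p : J p -> J (pihomog mdeg k p).
  move=> Jp l; have [->|kl] := eqVneq l k.
    by rewrite pihomog_id.
  exists 0; rewrite ?msize0 // (@pihomog_ne0 _ _ _ k) ?pihomogP //.
  by rewrite eq_sym.
have [[v [vi vJ]]|nilJ] := projective_nullstellensatz J0 JD JM JH.
  exists v; split=> // k p q pk qk pq; apply: vJ => l.
  have [<-|kl] := eqVneq k l; first by exists q; rewrite ?pihomog_dE.
  by exists 0; rewrite ?msize0 // (pihomog_ne0 kl).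
exfalso; apply: infS.
have /choice[N NP] : forall i, exists N, exists2 q : {mpoly K[n]}, (msize q <= N)%N &
    agree ('X_i ^+ N) q.
  move=> i; have [N /(_ N)[q qN qP]] := nilJ i; exists N; exists q => //.
  move: qP; rewrite pihomog_dE // mpolyXn dhomogX /=.
  by rewrite mdegMn mdeg1 mul1n.
(* A monomial of degree at least [M] has some exponent [m i] with [N i <= m i], so its factor
   ['X_i ^+ N i] can be replaced by a polynomial of smaller degree. *)
pose M := (\sum_i N i).+1.
apply: (@finite_of_bounded_degree M) => p.
move: {-1}(msize p) (leqnn (msize p)) => k.
elim: k p => [|k IH] p pk.
  by exists p => //; apply: leq_trans pk _.
have good_sum (I : eqType) (r : seq I) (F : I -> {mpoly K[n]}) :
    {in r, forall i, exists2 q, (msize q <= M)%N & agree (F i) q} ->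
    exists2 q, (msize q <= M)%N & agree (\sum_(i <- r) F i) q.
  move=> Fr; rewrite big_seq.
  apply: (big_ind (fun p => exists2 q, (msize q <= M)%N & agree p q)) => //.
    by exists 0; rewrite ?msize0.
  move=> p1 p2 [q1 s1 a1] [q2 s2 a2]; exists (q1 + q2); last exact: agreeD.
  by apply: leq_trans (msizeD_le _ _) _; rewrite geq_max s1.
rewrite [p]mpolyE; apply: good_sum => m mp.
have mk : (mdeg m <= k)%N by rewrite -ltnS; apply: leq_trans pk; apply: msize_mdeg_lt.
suff [q qM qa] : exists2 q, (msize q <= M)%N & agree 'X_[m] q.
  exists (p@_m *: q); first exact: leq_trans (msizeZ_le _ _) qM.
  by rewrite -!mul_mpolyC; apply: agreeM.
have [mM|Mm] := ltnP (mdeg m) M; first by exists 'X_[m] => //; rewrite msizeX.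
have [i Ni] : exists i, (N i <= m i)%N.
  apply: contrapT => /forallNP noi; move: Mm; rewrite ltnNge mdegE => /negP; apply.
  by apply: leq_sum => i _; rewrite leqNgt; apply/negP => /ltnW /noi.
have [q qN qa] := NP i.
have le_m : (U_(i) *+ N i <= m)%MM.
  by apply/mnm_lepP => j; rewrite mulmnE mnm1E; case: eqP => [<-|]; rewrite ?mul1n ?mul0n.
have Em : 'X_[m] = 'X_[m - U_(i) *+ N i] * 'X_i ^+ N i :> {mpoly K[n]}.
  by rewrite mpolyXn -mpolyXD submK.
have [|q' q'M q'a] := IH ('X_[m - U_(i) *+ N i] * q).
  apply: leq_trans mk; rewrite -[in X in (_ <= X)%N](submK le_m) mdegD mdegMn mdeg1 mul1n.
  by apply: msizeM_leq; rewrite ?msizeX.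
exists q' => // x Sx; rewrite -q'a // Em; exact: agreeM.
Qed.

End Infinity.

(** * Finite groups *)

Lemma msize_homog (R : nzRingType) n k (p : {mpoly R[n]}) :
  p \is k.-homog -> (msize p <= k.+1)%N.
Proof.
move=> pk; rewrite msizeE; apply/bigmax_leqP_seq => m mp _.
by rewrite (dhomog_mf pk mp).
Qed.

Section PolynomialFunctions.
Variables (K : closedFieldType) (V : vectType K).

Lemma vcoordD (v w : V) : vcoord (v + w) = vcoord v + vcoord w.
Proof. by apply/rowP => i; rewrite !mxE linearD. Qed.

Lemma vcoordZ c (v : V) : vcoord (c *: v) = c *: vcoord v.
Proof. by apply/rowP => i; rewrite !mxE linearZ. Qed.

Lemma vcoord_vbasis (v : V) : v = \sum_i vcoord v 0 i *: (vbasis {:V})`_i.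
Proof.
rewrite {1}(coord_vbasis (memvf v)); apply: eq_bigr => i _.
by rewrite mxE.
Qed.

Lemma polyfun_leP d (f : V -> K) : polyfun_le V d f <->
  exists2 p : {mpoly K[\dim {:V}]}, (msize p <= d.+1)%N &
    forall v, f v = meval_row p (vcoord v).
Proof.
split=> [[F Fh fE]|[p pd fE]].
  have /choice[P PP] : forall i : 'I_d.+1, exists p : {mpoly K[\dim {:V}]},
      p \is i.-homog /\ forall v, F i v = meval_row p (vcoord v).
    by move=> i; have [p ph pE] := Fh i; exists p.
  exists (\sum_i P i).
    apply: leq_trans (mmeasure_sum _ _ _ _) _; apply/bigmax_leqP => i _.
    by apply: leq_trans (msize_homog (PP i).1) _; rewrite ltnS -ltnS.
  move=> v; rewrite fE /meval_row raddf_sum /=.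
  by apply: eq_bigr => i _; rewrite (PP i).2.
exists (fun i v => meval_row (pihomog mdeg i p) (vcoord v)).
  by move=> i; exists (pihomog mdeg i p) => //; apply: pihomogP.
by move=> v; rewrite fE {1}(pihomog_partitionE pd) /meval_row raddf_sum.
Qed.

End PolynomialFunctions.

(** Read each vector as a univariate polynomial through its coordinates. The product of these
    nonzero polynomials has a nonroot [t], and evaluation at [t] is the required form. *)
Lemma exists_functional (K : closedFieldType) (V : vectType K) (r : seq V) :
  0 \notin r -> exists l : {linear V -> K^o}, {in r, forall v, l v != 0}.
Proof.
move=> r0; pose P (v : V) := rVpoly (vcoord v).
have P0 v : v \in r -> P v != 0.
  move=> vr; apply: contraNneq r0 => Pv0; suff <- : v = 0 by [].
  rewrite (vcoord_vbasis v) -(rVpolyK (vcoord v)) -/(P v) Pv0 linear0.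
  by apply: big1 => i _; rewrite mxE scale0r.
have : \prod_(v <- r) P v != 0.
  by rewrite prodf_seq_neq0; apply/allP => v vr /=; apply: P0.
case/closed_nonrootP => t; rewrite rootE horner_prod => Pt.
have lin : linear (fun v => (P v).[t] : K^o).
  by move=> c v w; rewrite /P vcoordD vcoordZ linearP /= hornerD hornerZ.
pose l := GRing.isLinear.Build K V K^o *:%R (fun v => (P v).[t] : K^o) lin.
pose L : {linear V -> K^o} := HB.pack (fun v => (P v).[t] : K^o) l.
exists L => v vr /=; apply: contraNneq Pt => Pv0.
by rewrite (big_rem v) //= Pv0 mul0r.
Qed.

Lemma separating_finite (K : closedFieldType) n (G : linAlgGroup K n) (V : Gmodule G)
    (s : seq 'M[K]_n) : uniq s -> lag_set G = [set` s] ->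
  separating V (polyinv_le V (size s)).
Proof.
move=> us GE.
have sG A : (A \in s) <-> lag_set G A by rewrite GE.
split=> [f [] //|x x' [f [_ finv] fx]].
(* If x' were [gm_act V A x], the invariant [f] would take equal values at x and x'. *)
have [|l lP] := @exists_functional K V [seq x' - gm_act V A x | A <- s].
  apply/mapP => -[A /sG GA] /esym/eqP; rewrite subr_eq0 => /eqP e.
  by apply: fx; rewrite e finv.
pose h v := \prod_(A <- s) (l x' - l (gm_act V A v)) : K.
have hle : polyfun_le V (size s) h.
  apply/polyfun_leP.
  exists (\prod_(A <- s) ((l x')%:MP -
      \sum_(i < \dim {:V}) (l (gm_act V A (vbasis {:V})`_i)) *: 'X_i)).
    rewrite {}/h; elim: {us GE sG lP}s => [|A s IH] /=; first by rewrite big_nil msize1.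
    rewrite big_cons -[(size s).+2]add1n; apply: msizeM_leq IH.
    apply: leq_trans (msizeD_le _ _) _.
    rewrite geq_max msizeN msizeC (leq_trans (leq_b1 _)) //=.
    apply: leq_trans (mmeasure_sum _ _ _ _) _; apply/bigmax_leqP => i _.
    by apply: leq_trans (msizeZ_le _ _) _; rewrite msizeX mdeg1.
  move=> v; rewrite /h /meval_row rmorph_prod /=; apply: eq_bigr => A _.
  rewrite mevalB mevalC; congr (_ - _); rewrite {1}(vcoord_vbasis v) !linear_sum /=.
  by apply: eq_bigr => i _; rewrite mevalZ mevalXU mulrC !linearZ.
exists h; last first.
  have -> : h x' = 0.
    rewrite /h (big_rem 1%:M) /=; last exact/sG/lag_1.
    by rewrite gm_act1 subrr mul0r.
  apply/eqP; rewrite prodf_seq_neq0; apply/allP => A As /=.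
  by rewrite -linearB; apply: lP; apply: map_f.
split=> //; split; first by have /polyfun_leP[p _ hE] := hle; exists p.
move=> A GA v; have uA := lag_unit GA.
(* Right multiplication by [A] permutes the group, hence the factors of [h]. *)
have inj : injective (fun B : 'M[K]_n => B *m A).
  exact: can_inj (mulmxK uA).
rewrite /h [RHS](perm_big [seq B *m A | B <- s]) /=.
  rewrite big_map; apply: eq_big_seq => B /sG GB.
  by rewrite gm_actM.
apply: uniq_perm; rewrite ?map_inj_uniq // => B; apply/idP/mapP => [Bs|[C Cs ->]].
  exists (B *m invmx A); last by rewrite mulmxKV.
  by apply/sG/lag_mul; [apply/sG|apply: lag_inv].
by apply/sG/lag_mul => //; apply/sG.
Qed.

(** * The module of matrices and tensors *)

Section PolynomialIn.
Variables (K : closedFieldType) (X : Type) (D : set X) (m : nat) (c : X -> 'rV[K]_m).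

(** A common frame for regularity of the action, with [D] the product of G and the module and 1 /
    det among the coordinates, and for polynomial functions on the module, with [D] everything. *)
Definition poly_in (f : X -> K) :=
  exists P : {mpoly K[m]}, forall x, D x -> f x = meval_row P (c x).

Lemma poly_in_cst a : poly_in (fun=> a).
Proof. by exists a%:MP => x _; rewrite /meval_row mevalC. Qed.

Lemma poly_in_coord i : poly_in (fun x => c x 0 i).
Proof. by exists 'X_i => x _; rewrite /meval_row mevalXU. Qed.

Lemma poly_inD f g : poly_in f -> poly_in g -> poly_in (fun x => f x + g x).
Proof.
move=> [P PE] [Q QE]; exists (P + Q) => x Dx.
by rewrite /meval_row mevalD [LHS]/= PE ?QE.
Qed.

Lemma poly_inM f g : poly_in f -> poly_in g -> poly_in (fun x => f x * g x).
Proof.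
move=> [P PE] [Q QE]; exists (P * Q) => x Dx.
by rewrite /meval_row mevalM [LHS]/= PE ?QE.
Qed.

Lemma poly_in_sum (I : Type) (r : seq I) (F : I -> X -> K) :
  (forall i, poly_in (F i)) -> poly_in (fun x => \sum_(i <- r) F i x).
Proof.
move=> FP; elim: r => [|i r [P PE]].
  by have [P PE] := poly_in_cst 0; exists P => x Dx; rewrite big_nil; apply: PE.
have [Q QE] := FP i; exists (Q + P) => x Dx.
by rewrite big_cons QE // PE // /meval_row mevalD.
Qed.

Lemma poly_in_prod (I : Type) (r : seq I) (F : I -> X -> K) :
  (forall i, poly_in (F i)) -> poly_in (fun x => \prod_(i <- r) F i x).
Proof.
move=> FP; elim: r => [|i r [P PE]].
  by have [P PE] := poly_in_cst 1; exists P => x Dx; rewrite big_nil; apply: PE.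
have [Q QE] := FP i; exists (Q * P) => x Dx.
by rewrite big_cons QE // PE // /meval_row mevalM.
Qed.

Lemma poly_in_ext f g : (forall x, D x -> f x = g x) -> poly_in f -> poly_in g.
Proof. by move=> fg [P PE]; exists P => x Dx; rewrite -fg // PE. Qed.

Lemma poly_in_det k (M : X -> 'M[K]_k) :
  (forall i j, poly_in (fun x => M x i j)) -> poly_in (fun x => \det (M x)).
Proof.
move=> MP; apply: poly_in_sum => s; apply: poly_inM; first exact: poly_in_cst.
by apply: poly_in_prod => i; apply: MP.
Qed.

End PolynomialIn.

Section Tensor.
Variables (K : closedFieldType) (n r : nat).

(* The r-th tensor power of K^n in coordinates; matrices act on the right. *)
Definition tensor := {ffun {ffun 'I_r -> 'I_n} -> K^o}.

Definition tensor_act (B : 'M[K]_n) (T : tensor) : tensor :=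
  [ffun k : {ffun 'I_r -> 'I_n} => \sum_l T l * \prod_s B (l s) (k s)].

Definition tensor_pow (y : 'rV[K]_n) : tensor :=
  [ffun k : {ffun 'I_r -> 'I_n} => \prod_s y 0 (k s)].

Lemma tensor_actM B C T : tensor_act C (tensor_act B T) = tensor_act (B *m C) T.
Proof.
apply/ffunP => k; rewrite !ffunE.
(* The middle index tuple [f] is summed last, so that distributivity turns its sum into a product of
   entries of [B *m C]. *)
transitivity (\sum_(f : {ffun 'I_r -> 'I_n}) \sum_l T l *
    (\prod_s (B (l s) (f s) * C (f s) (k s)))).
  apply: eq_bigr => f _; rewrite ffunE mulr_suml; apply: eq_bigr => l _.
  by rewrite -mulrA big_split.
rewrite exchange_big; apply: eq_bigr => l _.
rewrite -mulr_sumr -(bigA_distr_bigA (fun s j => B (l s) j * C j (k s))).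
by congr (_ * _); apply: eq_bigr => s _; rewrite mxE.
Qed.

Lemma tensor_act_pow B y : tensor_act B (tensor_pow y) = tensor_pow (y *m B).
Proof.
apply/ffunP => k; rewrite !ffunE.
under [RHS]eq_bigr => s _ do rewrite mxE.
rewrite bigA_distr_bigA; apply: eq_bigr => l _.
by rewrite ffunE -big_split.
Qed.

Lemma tensor_act1 T : tensor_act 1%:M T = T.
Proof.
apply/ffunP => k; rewrite ffunE (bigD1 k) //= [X in _ + X]big1 => [|l lk].
  by rewrite addr0 big1 ?mulr1 // => s _; rewrite mxE eqxx.
have [s ls] : exists s, l s != k s.
  by apply/existsP; rewrite -negb_forall; apply: contra lk => /eqfunP lk; apply/eqP/ffunP.
by rewrite (bigD1 s) //= mxE (negPf ls) mul0r mulr0.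
Qed.

Lemma tensor_act_linear B : linear (tensor_act B).
Proof.
move=> c T T'; apply/ffunP => k; rewrite !ffunE scaler_sumr -big_split.
by apply: eq_bigr => l _; rewrite !ffunE /= mulrDl -scalerAl.
Qed.

HB.instance Definition _ B :=
  GRing.isLinear.Build K tensor tensor _ (tensor_act B) (tensor_act_linear B).

Definition matrix_tensor : vectType K := ('M[K]_n * tensor)%type.

(** The inverse turns the right action on tensors into a left action. *)
Definition matrix_tensor_act (A : 'M[K]_n) (v : matrix_tensor) : matrix_tensor :=
  (A *m v.1, tensor_act (invmx A) v.2).

Lemma matrix_tensor_act_linear A : linear (matrix_tensor_act A).
Proof.
by move=> c v w; rewrite /matrix_tensor_act /= !linearP.
Qed.

HB.instance Definition _ A := GRing.isLinear.Build K matrix_tensor matrix_tensor _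
  (matrix_tensor_act A) (matrix_tensor_act_linear A).

Definition tensor_delta (k : {ffun 'I_r -> 'I_n}) : tensor :=
  [ffun l => (l == k)%:R].

Lemma tensor_sum (T : tensor) : T = \sum_k T k *: tensor_delta k.
Proof.
apply/ffunP => l; rewrite sum_ffunE (bigD1 l) //= big1 => [|k kl].
  by rewrite !ffunE eqxx addr0 [_ *: _]mulr1.
by rewrite !ffunE eq_sym (negPf kl) [_ *: _]mulr0.
Qed.

Definition inM (M : 'M[K]_n) : matrix_tensor := (M, 0).
Definition inT (T : tensor) : matrix_tensor := (0, T).

Lemma inM_linear : linear inM.
Proof.
by move=> c M N; rewrite /inM -[RHS]/(c *: M + N, c *: 0 + 0) scaler0 addr0.
Qed.

Lemma inT_linear : linear inT.
Proof.
by move=> c M N; rewrite /inT -[RHS]/(c *: 0 + 0, c *: M + N) scaler0 addr0.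
Qed.

HB.instance Definition _ :=
  GRing.isLinear.Build K 'M[K]_n matrix_tensor _ inM inM_linear.
HB.instance Definition _ :=
  GRing.isLinear.Build K tensor matrix_tensor _ inT inT_linear.

Lemma inMT (v : matrix_tensor) : v = inM v.1 + inT v.2.
Proof.
by case: v => M T; rewrite /inM /inT -[RHS]/(M + 0, 0 + T) addr0 add0r.
Qed.

(** The basis behind [vcoord] is not explicit; this lemma and the next four pass linearly between
    [vcoord] and the matrix and tensor entries. *)
Lemma vcoord_inM (M : 'M[K]_n) k :
  vcoord (inM M) 0 k = \sum_i \sum_j M i j * vcoord (inM (delta_mx i j)) 0 k.
Proof.
rewrite mxE {1}(matrix_sum_delta M) !linear_sum /=; apply: eq_bigr => i _.
rewrite !linear_sum /=; apply: eq_bigr => j _.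
by rewrite !linearZ /= mxE.
Qed.

Lemma vcoord_inT (T : tensor) k :
  vcoord (inT T) 0 k = \sum_l T l * vcoord (inT (tensor_delta l)) 0 k.
Proof.
rewrite mxE {1}(tensor_sum T) !linear_sum /=; apply: eq_bigr => l _.
by rewrite !linearZ /= mxE.
Qed.

Lemma vcoord_split (v : matrix_tensor) k :
  vcoord v 0 k = vcoord (inM v.1) 0 k + vcoord (inT v.2) 0 k.
Proof. by rewrite {1}(inMT v) vcoordD mxE. Qed.

Lemma fst_vcoord (v : matrix_tensor) i j :
  v.1 i j = \sum_k vcoord v 0 k * ((vbasis {:matrix_tensor})`_k).1 i j.
Proof.
rewrite {1}(vcoord_vbasis v) raddf_sum summxE; apply: eq_bigr => k _.
by rewrite mxE.
Qed.

Lemma snd_vcoord (v : matrix_tensor) l :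
  v.2 l = \sum_k (vcoord v 0 k * ((vbasis {:matrix_tensor})`_k).2 l : K) :> K.
Proof.
rewrite {1}(vcoord_vbasis v) raddf_sum sum_ffunE; apply: eq_bigr => k _.
by rewrite ffunE.
Qed.

End Tensor.

(** * The G-module structure and the contraction invariant *)

Section TensorModule.
Variables (K : closedFieldType) (n r : nat) (G : linAlgGroup K n).

Local Notation W := (@matrix_tensor K n r).

Definition matrix_tensor_gact (A : 'M[K]_n) : 'End(W) :=
  linfun (@matrix_tensor_act K n r A).

Lemma matrix_tensor_gactE A v : matrix_tensor_gact A v = matrix_tensor_act A v.
Proof. by rewrite lfunE. Qed.

Lemma invmxM (A B : 'M[K]_n) : A \in unitmx -> B \in unitmx ->
  invmx (A *m B) = invmx B *m invmx A.
Proof.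
move=> uA uB; have uAB : A *m B \in unitmx by rewrite unitmx_mul uA.
apply: (can_inj (mulKmx uAB)); rewrite mulmxV // mulmxA mulmxK //.
by rewrite mulmxV.
Qed.

Lemma matrix_tensor_gact1 (v : W) : matrix_tensor_gact 1%:M v = v.
Proof.
rewrite matrix_tensor_gactE /matrix_tensor_act invmx1 mul1mx tensor_act1.
by case: v.
Qed.

Lemma matrix_tensor_gactM A B : lag_set G A -> lag_set G B -> forall v : W,
  matrix_tensor_gact (A *m B) v = matrix_tensor_gact A (matrix_tensor_gact B v).
Proof.
move=> GA GB v; rewrite !matrix_tensor_gactE /matrix_tensor_act /=.
by rewrite invmxM ?(lag_unit GA) ?(lag_unit GB) // tensor_actM mulmxA.
Qed.

Lemma matrix_tensor_regular (i : 'I_(\dim {:W})) :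
  exists P : {mpoly K[n * n + 1 + \dim {:W}]}, forall A, lag_set G A -> forall v : W,
    vcoord (matrix_tensor_gact A v) 0 i = meval_row P (row_mx (GLcoord A) (vcoord v)).
Proof.
pose c (x : 'M[K]_n * W) := row_mx (GLcoord x.1) (vcoord x.2).
pose D : set ('M[K]_n * W) := [set x | lag_set G x.1].
suff [P PE] : poly_in D c (fun x => vcoord (matrix_tensor_gact x.1 x.2) 0 i).
  by exists P => A GA v; apply: (PE (A, v)).
have cV k : poly_in D c (fun x => vcoord x.2 0 k).
  by apply: poly_in_ext (poly_in_coord _ _ (rshift _ k)) => x _; rewrite row_mxEr.
have cA j k : poly_in D c (fun x => x.1 j k).
  apply: poly_in_ext (poly_in_coord _ _ (lshift _ (lshift _ (mxvec_index j k)))) => x _.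
  by rewrite !row_mxEl mxvecE.
(* By Cramer's rule the inverse is 1 / det times the adjugate, and 1 / det is the last entry of
   [GLcoord]. *)
have cI j k : poly_in D c (fun x => invmx x.1 j k).
  have cd : poly_in D c (fun x => (\det x.1)^-1).
    apply: poly_in_ext (poly_in_coord _ _ (lshift _ (rshift _ 0))) => x _.
    by rewrite row_mxEl row_mxEr mxE eqxx.
  apply: (@poly_in_ext _ _ _ _ _ (fun x => (\det x.1)^-1 * \adj x.1 j k)) => [x Dx|].
    by rewrite /invmx (lag_unit Dx) !mxE.
  apply: poly_inM => //.
  apply: (@poly_in_ext _ _ _ _ _
    (fun x => (-1) ^+ (k + j) * \det (row' k (col' j x.1)))) => [x Dx|].
    by rewrite mxE.
  apply: poly_inM; first exact: poly_in_cst.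
  apply: poly_in_det => a b.
  by apply: poly_in_ext (cA (lift k a) (lift j b)) => x _; rewrite !mxE.
have cM j k : poly_in D c (fun x => x.2.1 j k).
  apply: (poly_in_ext (fun x _ => esym (fst_vcoord _ _ _))).
  by apply: poly_in_sum => l; apply: poly_inM => //; apply: poly_in_cst.
have cT k : poly_in D c (fun x => x.2.2 k).
  have E (x : 'M[K]_n * W) (_ : D x) := esym (snd_vcoord x.2 k).
  apply: (poly_in_ext E); apply: poly_in_sum => l.
  by apply: poly_inM => //; apply: poly_in_cst.
pose F1 (x : 'M[K]_n * W) := \sum_j \sum_k (\sum_l x.1 j l * x.2.1 l k) *
  vcoord (inM r (delta_mx j k)) 0 i.
pose F2 (x : 'M[K]_n * W) := \sum_(k : {ffun 'I_r -> 'I_n}) (\sum_(l : {ffun 'I_r -> 'I_n})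
    x.2.2 l * \prod_s invmx x.1 (l s) (k s)) * vcoord (inT (tensor_delta K k)) 0 i.
apply: (@poly_in_ext _ _ _ _ _ (fun x => F1 x + F2 x)) => [x _|].
  rewrite matrix_tensor_gactE vcoord_split vcoord_inM vcoord_inT; congr (_ + _).
    by apply: eq_bigr => j _; apply: eq_bigr => k _; congr (_ * _); rewrite [RHS]mxE.
  by apply: eq_bigr => k _; congr (_ * _); rewrite [RHS]ffunE.
apply: poly_inD.
  do 2!apply: poly_in_sum => ?; apply: poly_inM; last exact: poly_in_cst.
  by apply: poly_in_sum => l; apply: poly_inM.
apply: poly_in_sum => k; apply: poly_inM; last exact: poly_in_cst.
apply: poly_in_sum => l; apply: poly_inM => //.
by apply: poly_in_prod => s.
Qed.

Definition tensor_module : Gmodule G :=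
  GModule matrix_tensor_gact1 matrix_tensor_gactM matrix_tensor_regular.

(* The contraction pairs T with the r-th tensor power of the j-th column of M. *)
Definition contraction (j : 'I_n) (v : W) : K := tensor_act v.1 v.2 [ffun=> j].

(** The factor [invmx A] on the tensor cancels against [A] in [A *m M]. *)
Lemma contraction_inv j : polyinv tensor_module (contraction j).
Proof.
split; last first.
  move=> A GA v; rewrite /= matrix_tensor_gactE /contraction /=.
  by rewrite tensor_actM mulKmx // (lag_unit GA).
have cV k : poly_in setT (@vcoord K W) (fun v => vcoord v 0 k) by apply: poly_in_coord.
suff [P PE] : poly_in setT (@vcoord K W)
    (fun v => \sum_(l : {ffun 'I_r -> 'I_n}) (v.2 l * \prod_s v.1 (l s) j : K)).
  exists P => v; rewrite -PE //.
  rewrite /contraction [LHS]ffunE; apply: eq_bigr => l _; congr (_ * _).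
  by apply: eq_bigr => s _; rewrite ffunE.
apply: poly_in_sum => l; apply: poly_inM.
  have E (v : W) (_ : setT v) := esym (snd_vcoord v l).
  apply: (poly_in_ext E); apply: poly_in_sum => k.
  by apply: poly_inM => //; apply: poly_in_cst.
apply: poly_in_prod => s; apply: (poly_in_ext (fun x _ => esym (fst_vcoord _ _ _))).
by apply: poly_in_sum => k; apply: poly_inM => //; apply: poly_in_cst.
Qed.

Lemma contraction_pow (M : 'M[K]_n) (y : 'rV[K]_n) j :
  contraction j (M, tensor_pow r y) = (y *m M) 0 j ^+ r.
Proof.
rewrite /contraction tensor_act_pow ffunE.
under eq_bigr => s _ do rewrite ffunE.
by rewrite prodr_const card_ord.
Qed.

End TensorModule.

(** * Invariants of low degree *)

Lemma coef_affine (R : nzRingType) (a b : R) j :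
  (a%:P + 'X * b%:P)`_j = if j == 0%N then a else if j == 1%N then b else 0.
Proof.
rewrite coefD coefXM !coefC; case: j => [|[|j]] /=;
  by rewrite ?addr0 ?add0r.
Qed.

Section Substitution.
Variables (K : closedFieldType) (N k : nat).

Local Notation subst h p := (mmap (polyC \o @mpolyC N K) h p).

(** The outer variable is a parameter t that will scale the tensor, so that the coefficient of t^b
    isolates the part of degree b in it. *)
Lemma subst_eval (h : 'I_k -> {poly {mpoly K[N]}}) p x t :
  (map_poly (meval x) (subst h p)).[t] =
  p.@[fun i => (map_poly (meval x) (h i)).[t]].
Proof.
rewrite /mmap rmorph_sum horner_sum mevalE; apply: eq_bigr => m _.
rewrite rmorphM hornerM /= map_polyC /= hornerC mevalC; congr (_ * _).
rewrite /mmap1 rmorph_prod horner_prod; apply: eq_bigr => i _.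
by rewrite rmorphXn horner_exp.
Qed.

(** Each factor t comes with one form of degree [r], and this grading is preserved by sums and
    products. *)
Lemma coef_subst_homog r (a : 'I_k -> K) (h : 'I_k -> {mpoly K[N]}) p b :
  (forall i, h i \is r.-homog) ->
  (subst (fun i => (a i)%:MP%:P + 'X * (h i)%:P) p)`_b \is (r * b).-homog.
Proof.
move=> hr; pose H (Q : {poly {mpoly K[N]}}) := forall b, Q`_b \is (r * b).-homog.
have HC c : H c%:MP%:P.
  move=> j; rewrite coefC; case: eqP => [->|_]; last exact: rpred0.
  by rewrite muln0 -(mulr1 c%:MP) mul_mpolyC; apply: rpredZ; apply: dhomog1.
have HM P Q : H P -> H Q -> H (P * Q).
  move=> HP HQ j; rewrite coefM; apply: rpred_sum => i _.
  have ij : (i <= j)%N by rewrite -ltnS.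
  rewrite (_ : (r * j = r * i + r * (j - i))%N); first exact: dhomogM.
  by rewrite -mulnDr subnKC.
have HD P Q : H P -> H Q -> H (P + Q).
  by move=> HP HQ j; rewrite coefD; apply: rpredD.
move: b; rewrite /mmap; apply: (big_ind H) => [|//|m _].
  by move=> j; rewrite coef0 rpred0.
apply: (HM) => /=; first exact: HC.
apply: (big_ind H) => [|//|i _]; first exact: (HC 1).
elim: (m i) => [|e IH]; first exact: (HC 1).
rewrite exprS; apply: (HM) => // j; rewrite coef_affine; case: eqP => [->|_].
  by have := HC (a i) 0%N; rewrite coefC.
by case: eqP => [->|_]; rewrite ?muln1 ?rpred0.
Qed.

(** Here t carries only constants and each [h i] has degree at most 1, so substitution does not
    raise the degree in the inner variables. *)
Lemma coef_subst_size d (a : 'I_k -> K) (h : 'I_k -> {mpoly K[N]}) p b :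
  (forall i, (msize (h i) <= 2)%N) -> (msize p <= d.+1)%N ->
  (msize (subst (fun i => (h i)%:P + 'X * (a i)%:MP%:P) p)`_b <= d.+1)%N.
Proof.
move=> hs pd.
pose H e (Q : {poly {mpoly K[N]}}) := forall b, (msize Q`_b <= e.+1)%N.
have HC c : H 0%N c%:MP%:P.
  move=> j; rewrite coefC; case: eqP => _; last by rewrite msize0.
  by rewrite msizeC leq_b1.
have Hsum e (I : eqType) (s : seq I) F : {in s, forall i, H e (F i)} ->
    H e (\sum_(i <- s) F i).
  move=> HF j; rewrite coef_sum (leq_trans (mmeasure_sum _ _ _ _)) //.
  by apply/bigmax_leqP_seq => i si _; apply: HF.
have HM e1 e2 P Q : H e1 P -> H e2 Q -> H (e1 + e2)%N (P * Q).
  move=> HP HQ j; rewrite coefM (leq_trans (mmeasure_sum _ _ _ _)) //.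
  by apply/bigmax_leqP => i _; rewrite -addnS; apply: msizeM_leq.
have Hle e1 e2 P : (e1 <= e2)%N -> H e1 P -> H e2 P.
  by move=> le HP j; apply: leq_trans (HP j) _.
move: b; rewrite /mmap; apply: Hsum => m mp.
apply: (@Hle (mdeg m)); first by rewrite -ltnS (leq_trans _ pd) ?msize_mdeg_lt.
rewrite -[mdeg m]add0n; apply: (HM); first exact: HC.
rewrite mdegE; apply: (big_ind2 H) => [||i _]; first exact: (HC 1).
  by move=> *; apply: HM.
elim: (m i) => [|e IH]; first exact: (HC 1).
rewrite exprS -[e.+1]add1n; apply: (HM) => // j.
rewrite coef_affine; case: eqP => _; first exact: hs.
case: eqP => _; last by rewrite msize0.
by rewrite msizeC (leq_trans (leq_b1 _)).
Qed.

End Substitution.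

Lemma poly_eq_horner (K : closedFieldType) (P Q : {poly K}) :
  (forall t, P.[t] = Q.[t]) -> P = Q.
Proof.
move=> PQ; apply/eqP; rewrite -subr_eq0; apply/negP => /negP/closed_nonrootP[t].
by rewrite rootE hornerD hornerN PQ subrr eqxx.
Qed.

Section LowDegree.
Variables (K : closedFieldType) (n r : nat) (G : linAlgGroup K n).

Local Notation mpt M := (fun k => mxvec M 0 k).
Local Notation W := (@matrix_tensor K n r).
Local Notation subst h p := (mmap (polyC \o @mpolyC (n * n) K) h p).

(** Coordinate [k] of (M, 0) for a generic matrix M. *)
Definition fst_form (k : 'I_(\dim {:W})) : {mpoly K[n * n]} :=
  \sum_i \sum_j vcoord (inM r (delta_mx i j)) 0 k *: 'X_(mxvec_index i j).

(** Coordinate [k] of (0, y) for y the r-th tensor power of row [i0] of a generic matrix. *)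
Definition snd_form (i0 : 'I_n) (k : 'I_(\dim {:W})) : {mpoly K[n * n]} :=
  \sum_(l : {ffun 'I_r -> 'I_n}) vcoord (inT (tensor_delta K l)) 0 k *:
    \prod_s 'X_(mxvec_index i0 (l s)).

Lemma fst_form_size k : (msize (fst_form k) <= 2)%N.
Proof.
do 2!(apply: leq_trans (mmeasure_sum _ _ _ _) _; apply/bigmax_leqP => ? _).
by apply: leq_trans (msizeZ_le _ _) _; rewrite msizeX mdeg1.
Qed.

Lemma snd_form_homog i0 k : snd_form i0 k \is r.-homog.
Proof.
apply: rpred_sum => l _; apply: rpredZ.
have -> : \prod_s 'X_(mxvec_index i0 (l s)) =
    'X_[\sum_s U_(mxvec_index i0 (l s))] :> {mpoly K[n * n]}.
  by rewrite (big_morph _ (@mpolyXD _ _) (@mpolyX0 _ _)).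
rewrite dhomogX /= mdeg_sum; under eq_bigr => s _ do rewrite mdeg1.
by rewrite sum1_card card_ord.
Qed.

Lemma fst_form_eval M k : (fst_form k).@[mpt M] = vcoord (inM r M) 0 k.
Proof.
rewrite vcoord_inM /fst_form raddf_sum; apply: eq_bigr => i _.
rewrite raddf_sum; apply: eq_bigr => j _.
by rewrite /= mevalZ mevalXU mxvecE mulrC.
Qed.

Lemma snd_form_eval i0 M k :
  (snd_form i0 k).@[mpt M] = vcoord (inT (tensor_pow r (row i0 M))) 0 k.
Proof.
rewrite vcoord_inT /snd_form raddf_sum; apply: eq_bigr => l _.
rewrite /= mevalZ rmorph_prod mulrC [in RHS]ffunE; congr (_ * _).
by apply: eq_bigr => s _; rewrite /= mevalXU mxvecE mxE.
Qed.

Lemma low_degree_invariant d (F : W -> K) (B : 'M[K]_n) i0 : (d < r)%N ->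
  polyinv_le (tensor_module r G) d F ->
  (forall k p q, p \is k.-homog -> (msize q <= k)%N ->
    agree [set x | exists2 A, lag_set G A & x = mpt A] p q -> p.@[mpt B] = 0) ->
  F (1%:M, tensor_pow r (row i0 B)) = F (1%:M, 0).
Proof.
move=> dr [[_ Finv] /polyfun_leP[p pd FE]] Binf.
(* With e the row [i0] of the identity, [P1] is F at (M, t e^r) and [P2] is F at (1, t (e M)^r),
   powers being tensor powers and M generic. *)
pose P1 := subst (fun k => (fst_form k)%:P + 'X * ((snd_form i0 k).@[mpt 1%:M])%:MP%:P) p.
pose P2 := subst (fun k => ((fst_form k).@[mpt 1%:M])%:MP%:P + 'X * (snd_form i0 k)%:P) p.
have FM (M : 'M[K]_n) (T : tensor K n r) t : F (M, t *: T) =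
    p.@[fun k => vcoord (inM r M) 0 k + t * vcoord (inT T) 0 k].
  rewrite FE /meval_row; apply: meval_eq => k.
  rewrite [LHS]vcoord_split (_ : vcoord (inT _) = t *: vcoord (inT T)).
    by congr (_ + _); rewrite [LHS]mxE.
  by rewrite -vcoordZ -linearZ.
have ev1 M t : (map_poly (meval (mpt M)) P1).[t] = F (M, t *: tensor_pow r (row i0 1%:M)).
  rewrite subst_eval FM; apply: meval_eq => k.
  rewrite rmorphD rmorphM /= map_polyX !map_polyC /= hornerD hornerM hornerX !hornerC.
  by rewrite mevalC fst_form_eval snd_form_eval.
have ev2 M t : (map_poly (meval (mpt M)) P2).[t] = F (1%:M, t *: tensor_pow r (row i0 M)).
  rewrite subst_eval FM; apply: meval_eq => k.
  rewrite rmorphD rmorphM /= map_polyX !map_polyC /= hornerD hornerM hornerX !hornerC.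
  by rewrite mevalC fst_form_eval snd_form_eval.
have homP2 b : P2`_b \is (r * b).-homog.
  by apply: coef_subst_homog => k; apply: snd_form_homog.
have sizeP1 b : (msize P1`_b <= d.+1)%N.
  by apply: coef_subst_size pd => k; apply: fst_form_size.
clearbody P1 P2.
(* For A in G, the action of A sends (1, t (e A)^r) to (A, t e^r), so [P1] and [P2] agree at A. *)
have onG b : agree [set x | exists2 A, lag_set G A & x = mpt A] P2`_b P1`_b.
  move=> _ [A GA ->].
  suff /(congr1 (fun Q : {poly K} => Q`_b)) :
      map_poly (meval (mpt A)) P2 = map_poly (meval (mpt A)) P1 by rewrite !coef_map.
  apply: poly_eq_horner => t; rewrite [LHS]ev2 [RHS]ev1.
  rewrite -(Finv A GA) /= matrix_tensor_gactE /matrix_tensor_act /= mulmx1.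
  by rewrite linearZ /= tensor_act_pow -row_mul mulmxV // (lag_unit GA).
(* For positive b the form has degree [r * b], which exceeds the bound [d] on the degree of the
   coefficient of [P1]. *)
have van b : (0 < b)%N -> (P2`_b).@[mpt B] = 0.
  move=> b0; apply: (Binf (r * b)%N _ P1`_b) (onG b) => //.
  by apply: leq_trans (sizeP1 b) (leq_trans dr _); rewrite leq_pmulr.
(* At [B] only the constant term in t survives, so t = 1 and t = 0 give the same value; [B] may be
   singular. *)
have := ev2 B 1; have := ev2 B 0; rewrite scale1r scale0r => <- <-.
have -> : map_poly (meval (mpt B)) P2 = ((P2`_0).@[mpt B])%:P.
  by apply/polyP => -[|b]; rewrite coef_map coefC //= van.
by rewrite !hornerC.
Qed.

End LowDegree.

(** * Finiteness of [beta_sep] and the equivalence *)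

Lemma min_enat_neq_Infty (A : set nat) : min_enat A <> Infty <-> exists d, A d.
Proof.
rewrite /min_enat; case: pselect => [[d Ad]|nA]; split=> //.
  by move=> _; exists d; apply/asboolP.
by move=> [d Ad]; case: nA; exists d; apply/asboolP.
Qed.

Lemma min_enat_leP (A : set nat) d : le_enat (min_enat A) (Fin d) <->
  exists2 e, A e & (e <= d)%N.
Proof.
rewrite /min_enat; case: pselect => [exA|nA]; last first.
  by split=> // -[e Ae _]; case: nA; exists e; apply/asboolP.
case: ex_minnP => m /asboolP Am mmin; split=> /= [md|[e Ae ed]]; first by exists m.
by apply: leq_trans (mmin e _) ed; apply/asboolP.
Qed.

Lemma beta_sep_neq_Infty (K : closedFieldType) n (G : linAlgGroup K n) :
  beta_sep G <> Infty <-> exists d, forall V : Gmodule G,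
    exists2 e, separating V (polyinv_le V e) & (e <= d)%N.
Proof.
rewrite /beta_sep /sup_enat; split=> [/min_enat_neq_Infty[d dP]|[d dP]].
  by exists d => V; apply/min_enat_leP; apply: dP; exists V.
by apply/min_enat_neq_Infty; exists d => _ [V ->]; apply/min_enat_leP/dP.
Qed.

Theorem theoremA (K : closedFieldType) (n : nat) (G : linAlgGroup K n) :
  finite_set (lag_set G) <-> beta_sep G <> Infty.
Proof.
split=> [/finite_seqP[s GE]|/beta_sep_neq_Infty[d dP]].
  (* Removing repetitions makes the bound the order of the group. *)
  apply/beta_sep_neq_Infty; exists (size (undup s)) => V.
  exists (size (undup s)) => //; apply: separating_finite (undup_uniq s) _.
  by rewrite GE; apply/seteqP; split=> A /=; rewrite mem_undup.
apply: contrapT => infG.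
pose S := [set x : 'I_(n * n) -> K | exists2 A, lag_set G A & x = fun k => mxvec A 0 k].
have [finS|v [[k0 vk0] vinf]] := @point_at_infinity K (n * n) S.
  apply: infG; apply: sub_finite_set (finite_image (fun x => vec_mx (\row_k x k)) finS).
  move=> A GA; exists (fun k => mxvec A 0 k); first by exists A.
  by apply: (can_inj mxvecK); rewrite vec_mxK; apply/rowP => k; rewrite mxE.
pose B : 'M[K]_n := vec_mx (\row_k v k).
have vE : v = fun k => mxvec B 0 k by apply/funext => k; rewrite vec_mxK mxE.
have [i [j Bij]] : exists i j, B i j != 0.
  by case/mxvec_indexP: k0 vk0 => i j; rewrite vE mxvecE; exists i, j.
(* The tensor exponent [d.+1] exceeds every degree [e <= d]. *)
have [e [_ sep] ed] := dP (tensor_module d.+1 G).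
have [|h hle] := sep (1%:M, tensor_pow d.+1 (row i B)) (1%:M, 0).
  exists (contraction j); first exact: contraction_inv.
  (* The two values of the contraction are [B i j ^+ d.+1] and 0. *)
  rewrite contraction_pow /contraction mulmx1 mxE tensor_act1 ffunE.
  by apply/eqP; rewrite expf_neq0.
apply; apply: (low_degree_invariant (d := e)) hle _ => //.
by move: vinf; rewrite vE.
Qed.
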